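(* Let $n\ge 3$ be an integer, $0<m<\frac{n-2}{n}$, $\gamma>0$ with $\gamma\ne\frac{2}{1-m}$, and $\eta>0$. Suppose $\alpha\in\mathbb{R}$ and $\beta\in\mathbb{R}\setminus\{0\}$ satisfy either $$\alpha=\frac{2\beta-1}{1-m}\quad\text{ or }\quad\alpha=\frac{2\beta+1}{1-m},$$ and $\gamma\ne\alpha/\beta$. Then the equation $$\Delta (f^m/m)+\alpha f+\beta x\cdot\nabla f=0,\quad f>0,\quad\text{ in }\mathbb{R}^n\setminus\{0\}$$ does not have any radially symmetric solution $f$ that satisfies $$\lim_{|x|\to 0}|x|^{\gamma}f(x)=\eta.$$
   Context: ''Solution'' means a classical (twice continuously differentiable) positive function satisfying the equation pointwise on $\mathbb{R}^n\setminus\{0\}$. Radially symmetric means that $f(x)$ depends only on $|x|$. *)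

(* Defs.v *)
From HB Require Import structures.
From mathcomp Require Import all_boot all_order all_algebra.
From mathcomp Require Import all_classical all_reals all_analysis.

Set Implicit Arguments.
Unset Strict Implicit.
Unset Printing Implicit Defensive.

Import Order.TTheory GRing.Theory Num.Theory.
Import numFieldNormedType.Exports.

Local Open Scope classical_set_scope.
Local Open Scope ring_scope.

(* The library norm `|x| on 'rV[R]_n is the sup norm (it induces the usual
   topology), so the Euclidean norm is defined separately. *)
Definition enorm (R : realType) (n : nat) (x : 'rV[R]_n) : R :=
  Num.sqrt (\sum_(i < n) x ord0 i ^+ 2).

Definition partial (R : realType) (n : nat) (i : 'I_n) (f : 'rV[R]_n -> R)
    (x : 'rV[R]_n) : R :=
  'D_(delta_mx ord0 i) f x.

Definition laplacian (R : realType) (n : nat) (f : 'rV[R]_n -> R)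
    (x : 'rV[R]_n) : R :=
  \sum_(i < n) partial i (partial i f) x.

Definition grad (R : realType) (n : nat) (f : 'rV[R]_n -> R)
    (x : 'rV[R]_n) : 'rV[R]_n :=
  \row_(i < n) partial i f x.

Definition dotprod (R : realType) (n : nat) (x y : 'rV[R]_n) : R :=
  \sum_(i < n) x ord0 i * y ord0 i.

(* Meant for U open, where existence and continuity of all the partial
   derivatives is the usual notion of class C^1. *)
Definition C1_on (R : realType) (n : nat) (U : set 'rV[R]_n)
    (f : 'rV[R]_n -> R) : Prop :=
  forall (i : 'I_n) (x : 'rV[R]_n), U x ->
    derivable f x (delta_mx ord0 i) /\ {for x, continuous (partial i f)}.

Definition C2_on (R : realType) (n : nat) (U : set 'rV[R]_n)
    (f : 'rV[R]_n -> R) : Prop :=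
  C1_on U f /\ forall i : 'I_n, C1_on U (partial i f).

Definition punctured (R : realType) (n : nat) : set 'rV[R]_n :=
  [set x | x != 0].

(* f is a total function, but its value at 0 is never constrained. *)
Definition is_solution (R : realType) (n : nat) (m alpha beta : R)
    (f : 'rV[R]_n -> R) : Prop :=
  [/\ C2_on (@punctured R n) f,
      forall x : 'rV[R]_n, x != 0 -> 0 < f x
    & forall x : 'rV[R]_n, x != 0 ->
        laplacian (fun y => f y `^ m / m) x + alpha * f x
          + beta * dotprod x (grad f x) = 0].

Definition radially_symmetric (R : realType) (n : nat)
    (f : 'rV[R]_n -> R) : Prop :=
  forall x y : 'rV[R]_n, x != 0 -> y != 0 -> enorm x = enorm y -> f x = f y.

(* Main.v *)
Require Import Defs.
From mathcomp Require Import all_boot all_order all_algebra.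
From mathcomp Require Import all_classical all_reals all_analysis.
From mathcomp Require Import ring lra.
Import Order.TTheory GRing.Theory Num.Theory.
Import numFieldNormedType.Exports.
Local Open Scope classical_set_scope.
Local Open Scope ring_scope.

(** A radial solution is determined by its profile phi(r) = f(r e), with e a
    coordinate vector. Put u = phi^m / m. The equation becomes the ordinary
    differential equation
      u'' + (n-1)/r u' + alpha phi + beta r phi' = 0   for r > 0,
    and the question is which exponents gamma are compatible with
    r^gamma phi(r) --> eta > 0 as r --> 0.

    For any real k, put P = r^k u and Q = r^(k+2) phi. With
      B = r^(k+1) u' + (n-2-k) P + beta Q
    the differential equation turns into the first-order system
      r B' = (beta (k+2) - alpha) Q + k (n-2-k) P,
      r P' = B + (2k-n+2) P - beta Q,
    in which no derivative of phi or u is left. Suppose that P --> p and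
    Q --> q. If r B' had a nonzero limit, B would diverge like log r, hence so
    would r P', and then P would be unbounded, which it is not. So
      (beta (k+2) - alpha) q + k (n-2-k) p = 0    ([profile_limit_balance]).
    The convergence of r^gamma phi alone carries the argument, which thus
    avoids asymptotics for the derivatives of phi.

    The exponent k is now chosen so that one of p, q vanishes, the dominant
    term of the equation being the diffusion or the linear part according to
    the sign of gamma - 2/(1-m).
    - If gamma < 2/(1-m), take k = m gamma. Then p = eta^m / m and q = 0, so
      m gamma = n - 2 ([slow_blowup]): the only singularity left is that of the
      fundamental solution. But m < (n-2)/n means (n-2)/m > 2/(1-m).
    - If gamma > 2/(1-m), take k = gamma - 2. Then p = 0 and q = eta, so
      alpha = beta gamma ([fast_blowup]), that is gamma = alpha/beta.
    Both conclusions contradict the hypotheses. *)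

Set Implicit Arguments.
Unset Strict Implicit.

(** * Directional derivatives *)

(** A directional derivative is a derivative of one real variable; this is what
    makes the one-variable chain rule available for it. *)
Lemma is_derive_line (R : numFieldType) (V W : normedModType R)
    (f : V -> W) (x v : V) (df : W) :
  is_derive x v f df <-> is_derive (0 : R) 1 (fun h : R => f (h *: v + x)) df.
Proof.
have E : 'D_v f x = 'D_1 (fun h : R => f (h *: v + x)) 0.
  rewrite /derive; set g1 := fun h => h^-1 *: _; set g2 := fun h => h^-1 *: _.
  suff -> : g1 = g2 by [].
  by apply/funext => h; rewrite /g1 /g2 /= addr0 scale0r add0r [_%:A]mulr1.
split=> -[D dE].
- by constructor; [exact/(derivable1P f x v) | rewrite -E].
- by constructor; [exact/derivable1P | rewrite E].
Qed.

Lemma is_derive_compR (R : realType) (V : normedModType R)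
    (g : V -> R) (f : R -> R) (x v : V) (a b : R) :
  is_derive (g x) 1 f a -> is_derive x v g b -> is_derive x v (f \o g) (a * b).
Proof.
move=> Df /is_derive_line Dg; apply/is_derive_line.
apply: (@is_derive1_comp _ f (fun h : R => g (h *: v + x))).
by rewrite scale0r add0r.
Qed.

Lemma is_derive_coord (R : realType) (n : nat) (x v : 'rV[R]_n) (j : 'I_n) :
  is_derive x v (fun y : 'rV[R]_n => y ord0 j) (v ord0 j).
Proof.
apply/is_derive_line.
have -> : (fun h : R => (h *: v + x) ord0 j) = (fun h : R => v ord0 j * h + x ord0 j).
  by apply/funext => h; rewrite !mxE mulrC.
have D := is_deriveD (is_deriveZ (v ord0 j) (is_derive_id (0:R) (1:R)))
  (is_derive_cst (x ord0 j) (0:R) (1:R)).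
by apply: is_derive_eq D _; rewrite addr0 [_%:A]mulr1.
Qed.

Lemma is_derive_axis (R : realType) (V : normedModType R) (g : V -> R) (e : V)
    (r : R) :
  derivable g (r *: e) e ->
  is_derive r 1 (fun s : R => g (s *: e)) ('D_e g (r *: e)).
Proof.
move=> /derivableP /is_derive_line D; apply/is_derive_line.
suff -> : (fun h : R => g ((h *: (1 : R) + r) *: e)) = (fun h : R => g (h *: e + r *: e)) by [].
by apply/funext => h; rewrite scalerDl [_%:A]mulr1.
Qed.

(** * Radial functions *)

Lemma enorm_sqr_gt0 (R : realType) (n : nat) (x : 'rV[R]_n) :
  x != 0 -> 0 < \sum_(i < n) x ord0 i ^+ 2.
Proof.
move=> x0; rewrite lt_def sumr_ge0 ?andbT; last by move=> i _; exact: sqr_ge0.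
apply: contra x0 => /eqP s0; apply/eqP/rowP => i; rewrite mxE.
have /(_ i isT)/eqP := psumr_eq0P (fun i _ => sqr_ge0 (x ord0 i)) s0.
by rewrite sqrf_eq0 => /eqP.
Qed.

Lemma enorm_gt0 (R : realType) (n : nat) (x : 'rV[R]_n) : x != 0 -> 0 < enorm x.
Proof. by move=> x0; rewrite sqrtr_gt0 enorm_sqr_gt0. Qed.

Lemma sqr_enorm (R : realType) (n : nat) (x : 'rV[R]_n) :
  enorm x ^+ 2 = \sum_(i < n) x ord0 i ^+ 2.
Proof. by rewrite sqr_sqrtr// sumr_ge0// => i _; exact: sqr_ge0. Qed.

Lemma is_derive_enorm (R : realType) (n : nat) (x : 'rV[R]_n) (i : 'I_n) :
  x != 0 ->
  is_derive x (delta_mx ord0 i) (@enorm R n) (x ord0 i / enorm x).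
Proof.
move=> x0.
have Dq : is_derive x (delta_mx ord0 i)
    (\sum_(j < n) ((fun y : 'rV[R]_n => y ord0 j) ^+ 2)) (2 * x ord0 i).
  have D := @is_derive_sum _ _ _ n _ x (delta_mx ord0 i) _
    (fun j => is_deriveX 2 (is_derive_coord x (delta_mx ord0 i) j)).
  apply: is_derive_eq D _.
  rewrite (bigD1 i)//= big1 => [|j ji].
    by rewrite mxE !eqxx addr0 expr1 [_ *: _]mulr1.
  by rewrite mxE (negbTE ji) andbF scaler0.
have e0 := enorm_gt0 x0.
apply: (@is_derive_eq _ _ _ _ _ _ _ ((2 * enorm x)^-1 * (2 * x ord0 i))); last first.
  by field; rewrite gt_eqF.
have Eq : (\sum_(j < n) ((fun y : 'rV[R]_n => y ord0 j) ^+ 2)) =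
    fun y => \sum_(j < n) y ord0 j ^+ 2 by rewrite fct_sumE.
rewrite Eq in Dq; apply: is_derive_compR Dq.
exact/is_derive1_sqrt/enorm_sqr_gt0.
Qed.

Lemma near_neq0 (R : realType) (n : nat) (x : 'rV[R]_n) :
  x != 0 -> \forall y \near x, y != 0.
Proof. by move=> x0; apply: (@cvgr_neq0 _ _ _ (nbhs x) _ id x _ x0); exact: cvg_id. Qed.

(** Chain rule through the norm. Away from 0 the function U agrees with
    u o |.| near x, which suffices for differentiating it. *)
Lemma is_derive_radial (R : realType) (n : nat) (U : 'rV[R]_n -> R) (u : R -> R)
    (u' : R) (x : 'rV[R]_n) (i : 'I_n) :
  (forall y : 'rV[R]_n, y != 0 -> U y = u (enorm y)) -> x != 0 ->
  is_derive (enorm x) 1 u u' ->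
  is_derive x (delta_mx ord0 i) U (u' * (x ord0 i / enorm x)).
Proof.
move=> Uu x0 Du; apply: (@near_eq_is_derive _ _ _ (u \o @enorm R n)).
  by near=> y; rewrite /= Uu//; near: y; exact: near_neq0.
by apply: is_derive_compR => //; exact: is_derive_enorm.
Unshelve. all: by end_near. Qed.

(** The i-th second partial is
    u'' x_i^2/|x|^2 + u' (1/|x| - x_i^2/|x|^3); summing over i turns x_i^2 into
    |x|^2. *)
Lemma laplacian_radial (R : realType) (n : nat) (U : 'rV[R]_n -> R)
    (u u' u'' : R -> R) (x : 'rV[R]_n) :
  (forall y : 'rV[R]_n, y != 0 -> U y = u (enorm y)) ->
  (forall r : R, 0 < r -> is_derive r 1 u (u' r)) ->
  (forall r : R, 0 < r -> is_derive r 1 u' (u'' r)) ->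
  x != 0 ->
  laplacian U x = u'' (enorm x) + (n%:R - 1) / enorm x * u' (enorm x).
Proof.
move=> Uu Du Du' x0.
have e0 := enorm_gt0 x0; have e_neq0 : enorm x != 0 by rewrite gt_eqF.
have pU i y : y != 0 -> partial i U y = u' (enorm y) * (y ord0 i / enorm y).
  move=> y0; apply: derive_val; apply: (is_derive_radial (u := u)) => //.
  exact/Du/enorm_gt0.
have ppU i : partial i (partial i U) x =
    u'' (enorm x) * (x ord0 i ^+ 2 / enorm x ^+ 2) +
    u' (enorm x) * ((enorm x)^-1 - x ord0 i ^+ 2 / enorm x ^+ 3).
  apply: derive_val.
  have D1 : is_derive x (delta_mx ord0 i) (u' \o @enorm R n)
      (u'' (enorm x) * (x ord0 i / enorm x)).
    by apply: is_derive_radial => //; exact: Du'.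
  have D2 : is_derive x (delta_mx ord0 i) (GRing.inv \o @enorm R n)
      (- (enorm x) ^- 2 * (x ord0 i / enorm x)).
    apply: is_derive_radial => //.
    have := @is_deriveV _ id _ _ _ e_neq0 (is_derive_id (enorm x) (1 : R)).
    by move=> D; apply: is_derive_eq D _; rewrite [_%:A]mulr1.
  have Di : is_derive x (delta_mx ord0 i) (fun y : 'rV[R]_n => y ord0 i) 1.
    by apply: is_derive_eq (is_derive_coord x _ i) _; rewrite mxE !eqxx.
  have D := is_deriveM D1 (is_deriveM Di D2).
  apply: (@near_eq_is_derive _ _ _ ((u' \o @enorm R n) *
      ((fun y : 'rV[R]_n => y ord0 i) * (GRing.inv \o @enorm R n)))).
    by near=> y; rewrite pU//; near: y; exact: near_neq0.
  apply: is_derive_eq D _; rewrite /GRing.scale /=.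
  rewrite -[(_ * _) x]/(x ord0 i * (enorm x)^-1).
  by field.
rewrite /laplacian (eq_bigr _ (fun i _ => ppU i)) big_split /= -!mulr_sumr.
rewrite big_split /= sumr_const card_ord sumrN -!mulr_suml -sqr_enorm -mulr_natl.
by field.
Unshelve. all: by end_near. Qed.

Lemma enormZ_delta (R : realType) (n : nat) (i : 'I_n) (r : R) :
  0 <= r -> enorm (r *: delta_mx ord0 i : 'rV[R]_n) = r.
Proof.
move=> r0; rewrite /enorm (bigD1 i)//= big1 => [|j ji].
  by rewrite !mxE !eqxx mulr1 addr0 sqrtr_sqr ger0_norm.
by rewrite !mxE (negbTE ji) andbF mulr0 expr0n.
Qed.

Lemma scale_delta_neq0 (R : realType) (n : nat) (i : 'I_n) (r : R) :
  0 < r -> r *: delta_mx ord0 i != 0 :> 'rV[R]_n.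
Proof.
move=> r0; apply/eqP => /rowP/(_ i); rewrite !mxE !eqxx mulr1 => E.
by rewrite E ltxx in r0.
Qed.

Lemma cvg_scale_delta (R : realType) (n : nat) (i : 'I_n) :
  r *: delta_mx ord0 i @[r --> (0 : R)^'+] --> (0 : 'rV[R]_n)^'.
Proof.
have c0 : r *: delta_mx ord0 i @[r --> (0 : R)^'+] --> (0 : 'rV[R]_n).
  rewrite -(scale0r (delta_mx ord0 i)); apply: cvgZl.
  exact: cvg_at_right_filter cvg_id.
move=> A A0.
have h : \forall r \near (0 : R)^'+,
    r *: delta_mx ord0 i != 0 :> 'rV[R]_n -> A (r *: delta_mx ord0 i) := c0 _ A0.
apply: filterS2 h (nbhs_right_gt 0) => r Ar r0.
by apply: Ar; exact: scale_delta_neq0.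
Qed.

(** * Divergence from logarithmic slopes *)

(** A slope of at least d/r makes G - d log r nondecreasing, so near 0
    G lies below d log r plus a constant. *)
Lemma log_slope_unbounded (R : realType) (G G' : R -> R) (r0 d : R) :
  0 < r0 -> 0 < d ->
  (forall r : R, 0 < r < r0 -> is_derive r 1 G (G' r)) ->
  (forall r : R, 0 < r < r0 -> d <= r * G' r) ->
  forall C, exists2 r1, 0 < r1 <= r0 & forall r, 0 < r < r1 -> G r < C.
Proof.
move=> r00 d0 DG dG C; pose a := r0 / 2.
have a0 : 0 < a by rewrite divr_gt0.
have ar0 : a < r0 by rewrite /a; lra.
(* The value of ln r at which d log r + G a - d log a reaches C. *)
pose K := (C - G a) / d + ln a.
exists (Num.min a (expR K)).
  by rewrite lt_min a0 expR_gt0 ge_min (ltW ar0).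
move=> r /andP[r_gt0]; rewrite lt_min => /andP[ra rK].
pose H := fun s : R => G s - d * ln s.
have DH (s : R) : 0 < s < r0 -> is_derive s 1 H (G' s - d / s).
  move=> s0; have /andP[s_gt0 _] := s0.
  exact: is_deriveB (DG s s0) (is_deriveZ d (is_derive1_ln s_gt0)).
have in0 s : r <= s <= a -> 0 < s < r0.
  by move=> /andP[rs sa]; rewrite (lt_le_trans r_gt0 rs) (le_lt_trans sa ar0).
have DH' s : s \in `]r, a[ -> is_derive s 1 H (G' s - d / s).
  by rewrite in_itv/= => /andP[rs sa]; apply/DH/in0; rewrite !ltW.
have cH : {within `[r, a], continuous H}.
  apply: derivable_within_continuous => s; rewrite in_itv/= => /in0 s0.
  exact: (@ex_derive _ _ _ _ _ _ _ (DH s s0)).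
have [s + E] := MVT ra DH' cH; rewrite in_itv/= => /andP[rs sa].
have sr : 0 < s < r0 by apply: in0; rewrite !ltW.
have s0 : 0 < s by case/andP: sr.
have incr : 0 <= (G' s - d / s) * (a - r).
  rewrite mulr_ge0 ?subr_ge0 ?(ltW ra)// ler_pdivrMr// mulrC; exact: dG.
move: incr; rewrite -E /H => incr.
have lnr : ln r < K by rewrite -(expRK K) ltr_ln ?posrE ?expR_gt0.
have : d * ln r < d * K by rewrite ltr_pM2l.
rewrite /K mulrDr mulrCA divff ?gt_eqF// => ?; lra.
Qed.

(** B dives to -oo by [log_slope_unbounded], taking r P' along as r P' - B is bounded;
    [log_slope_unbounded] applied to -P then makes P unbounded near 0. *)
Lemma no_bounded_log_primitive (R : realType) (P P' B B' : R -> R) (M d r0 : R) :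
  0 < r0 -> 0 < d ->
  (forall r : R, 0 < r < r0 -> is_derive r 1 P (P' r)) ->
  (forall r : R, 0 < r < r0 -> is_derive r 1 B (B' r)) ->
  (forall r : R, 0 < r < r0 -> `|P r| <= M) ->
  (forall r : R, 0 < r < r0 -> `|r * P' r - B r| <= M) ->
  (forall r : R, 0 < r < r0 -> d <= r * B' r) ->
  False.
Proof.
move=> r00 d0 DP DB MP MPB dB.
have [r1 /andP[r10 r1r0] B1] := log_slope_unbounded r00 d0 DB dB (- M - 1).
have in0 r : 0 < r < r1 -> 0 < r < r0.
  by move=> /andP[-> /lt_le_trans]; exact.
have [|||r2 /andP[r20 r2r1] P2] := @log_slope_unbounded R (- P) (fun r => - P' r) r1 1 r10 _ _ _ (- M).
- exact: ltr01.
- by move=> r /in0 /DP D; exact: is_deriveN.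
- move=> r rr1; have := MPB r (in0 r rr1); have := B1 r rr1.
  by rewrite ler_norml mulrN => ? /andP[]; lra.
have h : 0 < r2 / 2 < r2 by apply/andP; split; lra.
have := P2 _ h; rewrite -[(- P) _]/(- P (r2 / 2)).
have : 0 < r2 / 2 < r0 by case/andP: h => ? ?; apply/andP; split; lra.
by move=> /MP; rewrite ler_norml => /andP[]; lra.
Qed.

(** * Balance of the limits *)

Lemma is_derive_powR_mul (R : realType) (k : R) (v : R -> R) (v' r : R) :
  0 < r -> is_derive r 1 v v' ->
  is_derive r 1 (fun s : R => s `^ k * v s)
    (r `^ k * (k * v r / r + v')).
Proof.
move=> r0 Dv; have D := is_deriveM (is_derive1_powR k r0) Dv.
apply: is_derive_eq D _; rewrite /GRing.scale /=.
rewrite powRD ?(gt_eqF r0) ?implybT// powR_inv1 ?ltW//; ring.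
Qed.

(** B is the combination of r^(k+1) u', P and Q whose derivative contains no
    derivative of u or phi once the equation is used, and which differs from r P' by a
    combination T of P and Q alone. The real N stands for the dimension. *)
Lemma profile_limit_balance (R : realType) (phi phi' u u' u'' : R -> R)
    (N alpha beta k p q : R) :
  (forall r : R, 0 < r -> is_derive r 1 phi (phi' r)) ->
  (forall r : R, 0 < r -> is_derive r 1 u (u' r)) ->
  (forall r : R, 0 < r -> is_derive r 1 u' (u'' r)) ->
  (forall r : R, 0 < r ->
     u'' r + (N - 1) / r * u' r + alpha * phi r + beta * (r * phi' r) = 0) ->
  r `^ k * u r @[r --> (0 : R)^'+] --> p ->
  r `^ (k + 2) * phi r @[r --> (0 : R)^'+] --> q ->
  (beta * (k + 2) - alpha) * q + k * (N - 2 - k) * p = 0.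
Proof.
move=> Dphi Du Du' ode cvgP cvgQ.
set L := _ + _; apply/eqP/negPn/negP => L0.
pose P r := r `^ k * u r; pose Q r := r `^ (k + 2) * phi r.
pose P' r := r `^ k * (k * u r / r + u' r).
pose B r := r `^ (k + 1) * u' r + (N - 2 - k) * P r + beta * Q r.
pose S r := (beta * (k + 2) - alpha) * Q r + k * (N - 2 - k) * P r.
have DP (r : R) : 0 < r -> is_derive r 1 P (P' r).
  by move=> r0; exact: is_derive_powR_mul (Du r r0).
have DB (r : R) : 0 < r -> is_derive r 1 B (S r / r).
  move=> r0.
  have D := is_deriveD (is_deriveD (is_derive_powR_mul (k + 1) r0 (Du' r r0))
     (is_deriveZ (N - 2 - k) (DP r r0)))
     (is_deriveZ beta (is_derive_powR_mul (k + 2) r0 (Dphi r r0))).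
  apply: is_derive_eq D _; rewrite /GRing.scale /= /S /P' /P /Q.
  have := ode r r0.
  have -> : r `^ (k + 1) = r `^ k * r.
    by rewrite powRD ?(gt_eqF r0) ?implybT// powRr1 ?ltW.
  have -> : r `^ (k + 2) = r `^ k * r ^+ 2.
    by rewrite powRD ?(gt_eqF r0) ?implybT// powR_mulrn ?ltW.
  move: (r `^ k) (u r) (u' r) (u'' r) (phi r) (phi' r) => w a b c f f' E.
  have -> : c = - ((N - 1) / r * b + alpha * f + beta * (r * f')) by lra.
  by field; rewrite gt_eqF.
have cvgS : S r @[r --> (0 : R)^'+] --> L.
  by apply: cvgD; apply: cvgM => //; exact: cvg_cst.
pose T r := (2 * k - N + 2) * P r - beta * Q r.
have cvgT : T r @[r --> (0 : R)^'+] --> (2 * k - N + 2) * p - beta * q.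
  by apply: cvgB; apply: cvgM => //; exact: cvg_cst.
have PB (r : R) : 0 < r -> r * P' r - B r = T r.
  move=> r0; rewrite /T /P' /B /P powRD ?(gt_eqF r0) ?implybT// powRr1 ?ltW//.
  by field; rewrite gt_eqF.
pose M := 1 + `|p| + `|(2 * k - N + 2) * p - beta * q|.
have [r0 r00 bnd] : exists2 r0, 0 < r0 & forall r, 0 < r < r0 ->
    [/\ `|P r| <= M, `|T r| <= M & `|L| / 2 < S r * Num.sg L].
  have h : \forall r \near (0 : R)^'+,
     [/\ `|P r| <= M, `|T r| <= M & `|L| / 2 < S r * Num.sg L].
    near=> r; split; near: r.
    - apply: (cvgr_norm_le _ cvgP); rewrite /M; have := normr_ge0 ((2 * k - N + 2) * p - beta * q); lra.
    - apply: (cvgr_norm_le _ cvgT); rewrite /M; have := normr_ge0 p; lra.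
    - apply: (@cvgr_gt _ _ _ _ _ (L * Num.sg L)).
        by apply: cvgM => //; exact: cvg_cst.
      by rewrite [L * _]mulrC -normrEsg; have := normr_gt0 L; rewrite L0; lra.
  case: h => e e0 he; exists e => // r /andP[r_gt0 re]; apply: he => //=.
  by rewrite sub0r normrN gtr0_norm.
have L2 : 0 < `|L| / 2 by rewrite divr_gt0 ?normr_gt0.
(* For L < 0 the same argument is run on -P and -B. *)
have [Lpos|Lneg|Lz] := ltgtP 0 L; last by rewrite -Lz eqxx in L0.
- apply: (@no_bounded_log_primitive R P P' B (fun r => S r / r) M _ r0 r00 L2).
  + by move=> r /andP[r_gt0 _]; exact: DP.
  + by move=> r /andP[r_gt0 _]; exact: DB.
  + by move=> r /bnd[].
  + by move=> r /[dup] /bnd[_ ? _] /andP[r_gt0 _]; rewrite PB.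
  + move=> r /[dup] /bnd[_ _ /ltW h] /andP[r_gt0 _].
    by rewrite mulrCA divff ?gt_eqF// mulr1; rewrite gtr0_sg// mulr1 in h.
- apply: (@no_bounded_log_primitive R (- P) (fun r => - P' r) (- B) (fun r => - (S r / r)) M _ r0 r00 L2).
  + by move=> r /andP[r_gt0 _]; apply: is_deriveN; exact: DP.
  + by move=> r /andP[r_gt0 _]; apply: is_deriveN; exact: DB.
  + by move=> r /bnd[h _ _]; rewrite -[(- P) r]/(- P r) normrN.
  + move=> r /[dup] /bnd[_ h _] /andP[r_gt0 _].
    by rewrite -[(- B) r]/(- B r) mulrN -opprD normrN PB.
  + move=> r /[dup] /bnd[_ _ /ltW h] /andP[r_gt0 _].
    by rewrite mulrN mulrCA divff ?gt_eqF// mulr1; rewrite ltr0_sg// mulrN1 in h.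
Unshelve. all: by end_near. Qed.

(** * Admissible singularities *)

Lemma cvg_powR (R : realType) (T : Type) (F : set_system T) (FF : Filter F)
    (g : T -> R) (m y : R) :
  0 < y -> g x @[x --> F] --> y -> g x `^ m @[x --> F] --> y `^ m.
Proof.
move=> y0 gy.
have c : {for y, continuous (fun t : R => t `^ m)}.
  apply/differentiable_continuous/derivable1_diffP.
  by apply: derivable_powR; rewrite in_itv/= y0.
exact: (continuous_cvg _ c gy).
Qed.

Section Profile.
Variables (R : realType) (N m alpha beta gamma eta : R) (phi phi' phi'' : R -> R).
Hypotheses (m_gt0 : 0 < m) (m_lt1 : m < 1).
Hypothesis phi_gt0 : forall r : R, 0 < r -> 0 < phi r.
Hypothesis Dphi : forall r : R, 0 < r -> is_derive r 1 phi (phi' r).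
Hypothesis Dphi' : forall r : R, 0 < r -> is_derive r 1 phi' (phi'' r).

Definition phipow r := phi r `^ m / m.
Definition phipow' r := phi r `^ (m - 1) * phi' r.
Definition phipow'' r :=
  phi r `^ (m - 1) * phi'' r + (m - 1) * phi r `^ (m - 2) * phi' r ^+ 2.

Lemma is_derive_phipow (r : R) : 0 < r -> is_derive r 1 phipow (phipow' r).
Proof.
move=> r0.
have D := is_derive_compR (is_derive1_powR m (phi_gt0 r0)) (Dphi r0).
have -> : phipow = m^-1 \*: ((fun t : R => t `^ m) \o phi).
  by apply/funext => s; rewrite /phipow mulrC.
apply: is_derive_eq (is_deriveZ m^-1 D) _; rewrite /GRing.scale /= /phipow'.
by field; rewrite gt_eqF.
Qed.

Lemma is_derive_phipow' (r : R) :
  0 < r -> is_derive r 1 phipow' (phipow'' r).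
Proof.
move=> r0.
have D := is_derive_compR (is_derive1_powR (m - 1) (phi_gt0 r0)) (Dphi r0).
apply: is_derive_eq (is_deriveM D (Dphi' r0)) _.
rewrite /GRing.scale /= /phipow''.
have -> : m - 1 - 1 = m - 2 by ring.
by ring.
Qed.

Hypothesis gamma_gt0 : 0 < gamma.
Hypothesis eta_gt0 : 0 < eta.
Hypothesis ode : forall r : R, 0 < r ->
  phipow'' r + (N - 1) / r * phipow' r + alpha * phi r
    + beta * (r * phi' r) = 0.
Hypothesis cvg_phi : r `^ gamma * phi r @[r --> (0 : R)^'+] --> eta.

Lemma cvg_phipow :
  r `^ (m * gamma) * phipow r @[r --> (0 : R)^'+] --> eta `^ m / m.
Proof.
have c : (r `^ gamma * phi r) `^ m / m @[r --> (0 : R)^'+] --> eta `^ m / m.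
  by apply: cvgM; [exact: cvg_powR | exact: cvg_cst].
apply: cvg_trans c; apply: near_eq_cvg; near=> r.
have r0 : 0 < r by near: r; exact: nbhs_right_gt.
by rewrite /phipow powRM ?powR_ge0 ?ltW ?phi_gt0// -powRrM (mulrC gamma) mulrA.
Unshelve. all: by end_near. Qed.

Lemma cvg_powR_shift (v : R -> R) (k l p : R) :
  k < l -> r `^ k * v r @[r --> (0 : R)^'+] --> p ->
  r `^ l * v r @[r --> (0 : R)^'+] --> (0 : R).
Proof.
move=> kl cv.
have c : r `^ (l - k) * (r `^ k * v r) @[r --> (0 : R)^'+] --> (0 : R).
  have lk : 0 < l - k by rewrite subr_gt0.
  by rewrite -[X in _ --> X](mul0r p); exact: cvgM (powR_cvg0 lk) cv.
apply: cvg_trans c; apply: near_eq_cvg; near=> r.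
have r0 : 0 < r by near: r; exact: nbhs_right_gt.
by rewrite mulrA -powRD ?(gt_eqF r0) ?implybT// subrK.
Unshelve. all: by end_near. Qed.

(** When r^gamma phi converges and gamma < m gamma + 2, the factor r^(m gamma + 2)
    kills phi while r^(m gamma) keeps u of order one: only the Laplacian is seen
    in the limit. *)
Lemma slow_blowup : gamma < 2 / (1 - m) -> m * gamma = N - 2.
Proof.
rewrite ltr_pdivlMr ?subr_gt0// => gm.
have lt : gamma < m * gamma + 2 by lra.
have := profile_limit_balance Dphi is_derive_phipow is_derive_phipow' ode
  cvg_phipow (cvg_powR_shift lt cvg_phi).
have h : m * gamma * (eta `^ m / m) != 0.
  by rewrite gt_eqF// !mulr_gt0 ?invr_gt0 ?powR_gt0.
rewrite mulr0 add0r mulrAC => /eqP; rewrite mulf_eq0 (negbTE h)/= => /eqP; lra.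
Qed.

(** When gamma - 2 > m gamma, the weight r^(gamma - 2) kills u while r^gamma keeps
    phi of order one: only alpha phi + beta r phi' is seen in the limit. *)
Lemma fast_blowup : 2 / (1 - m) < gamma -> alpha = beta * gamma.
Proof.
rewrite ltr_pdivrMr ?subr_gt0// => gm.
have lt : m * gamma < gamma - 2 by lra.
have cvgQ : r `^ (gamma - 2 + 2) * phi r @[r --> (0 : R)^'+] --> eta.
  by rewrite subrK.
have := profile_limit_balance Dphi is_derive_phipow is_derive_phipow' ode
  (cvg_powR_shift lt cvg_phipow) cvgQ.
rewrite mulr0 addr0 subrK => /eqP; rewrite mulf_eq0 (gt_eqF eta_gt0) orbF.
by move=> /eqP; lra.
Qed.

End Profile.

(** * Nonexistence *)

Unset Implicit Arguments.

Theorem corollary1p5 (R : realType) (n : nat) (m gamma eta alpha beta : R)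
    (hn : (3 <= n)%N)
    (hm0 : 0 < m) (hm1 : m < (n%:R - 2) / n%:R)
    (hgamma0 : 0 < gamma) (hgamma : gamma != 2 / (1 - m))
    (heta : 0 < eta)
    (hbeta : beta != 0)
    (halpha : alpha = (2 * beta - 1) / (1 - m) \/
              alpha = (2 * beta + 1) / (1 - m))
    (hgamma' : gamma != alpha / beta) :
  ~ exists f : 'rV[R]_n -> R,
      [/\ is_solution m alpha beta f,
          radially_symmetric f
        & (enorm x `^ gamma * f x) @[x --> (0 : 'rV[R]_n)^'] --> eta].
Proof.
move=> [f [[[C1f C1pf] f_gt0 eqf] symf cvgf]].
have n_gt0 : 0 < n%:R :> R by rewrite ltr0n; apply: leq_trans hn.
have mn : m * n%:R < n%:R - 2 by rewrite -ltr_pdivlMr.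
have m_lt1 : m < 1.
  by rewrite -(ltr_pM2r n_gt0) mul1r; apply: lt_trans mn _; lra.
pose i0 : 'I_n := Ordinal (leq_trans (isT : (0 < 3)%N) hn).
pose e : 'rV[R]_n := delta_mx ord0 i0.
have e_neq0 (r : R) : 0 < r -> r *: e != 0 by exact: scale_delta_neq0.
pose phi r := f (r *: e).
pose phi' r := partial i0 f (r *: e).
pose phi'' r := partial i0 (partial i0 f) (r *: e).
have phi_gt0 (r : R) : 0 < r -> 0 < phi r by move=> r0; exact/f_gt0/e_neq0.
have Dphi (r : R) : 0 < r -> is_derive r 1 phi (phi' r).
  by move=> r0; apply: is_derive_axis; exact: (C1f i0 _ (e_neq0 r r0)).1.
have Dphi' (r : R) : 0 < r -> is_derive r 1 phi' (phi'' r).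
  by move=> r0; apply: is_derive_axis; exact: (C1pf i0 i0 _ (e_neq0 r r0)).1.
have f_phi (y : 'rV[R]_n) : y != 0 -> f y = phi (enorm y).
  move=> y0; have ny := enorm_gt0 y0.
  by apply: symf => //; [exact: e_neq0 | rewrite enormZ_delta// ltW].
have ode (r : R) : 0 < r ->
    phipow'' m phi phi' phi'' r + (n%:R - 1) / r * phipow' m phi phi' r
      + alpha * phi r + beta * (r * phi' r) = 0.
  move=> r0; rewrite -[RHS](eqf _ (e_neq0 r r0)).
  have Uu (y : 'rV[R]_n) : y != 0 -> f y `^ m / m = phipow m phi (enorm y).
    by move=> y0; rewrite f_phi.
  rewrite (laplacian_radial Uu (is_derive_phipow hm0 phi_gt0 Dphi)
    (is_derive_phipow' m phi_gt0 Dphi Dphi') (e_neq0 r r0)).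
  rewrite enormZ_delta ?ltW//; congr (_ + _ + beta * _).
  rewrite /dotprod (bigD1 i0)//= big1 => [|j ji].
    by rewrite !mxE !eqxx mulr1 addr0.
  by rewrite !mxE (negbTE ji) andbF mulr0 mul0r.
have cvg_phi : r `^ gamma * phi r @[r --> (0 : R)^'+] --> eta.
  have c := cvg_comp _ _ (cvg_scale_delta (R := R) i0) cvgf.
  apply: cvg_trans c; apply: near_eq_cvg; near=> r.
  have r0 : 0 < r by near: r; exact: nbhs_right_gt.
  by rewrite /= enormZ_delta ?ltW.
have [slow|fast|E] := ltgtP gamma (2 / (1 - m)); last by rewrite E eqxx in hgamma.
- have E := slow_blowup hm0 m_lt1 phi_gt0 Dphi Dphi' hgamma0 heta ode cvg_phi slow.
  move: slow; rewrite ltr_pdivlMr ?subr_gt0// -(ltr_pM2l hm0) mulrA E => slow.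
  lra.
- have E := fast_blowup hm0 m_lt1 phi_gt0 Dphi Dphi' heta ode cvg_phi fast.
  by move/eqP: hgamma'; apply; rewrite E mulrC mulKf.
Unshelve. all: by end_near. Qed.
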